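(* Let $(G,H,\alpha,\tau)$ be a Lie crossed module, and $\overline A$ a connection on a principal $G$-bundle $\pi:P\to M$. Let $\tilde\gamma:[t_0,t_1]\to P$ be a piecewise $C^1$ $\overline A$-horizontal path in $P$, and $\tilde v:[t_0,t_1]\to TP$ a continuous vector field along $\tilde\gamma$ that satisfies $$\overline{A}(\tilde v(t))=\overline{A}(\tilde v(t_0))+\int_{t_0}^{t}F^{\overline{A}}\bigl(\tilde\gamma'(s),\tilde v(s)\bigr)\,ds\qquad\text{for all } t\in[t_0,t_1].$$ Let $A$ be a connection form on $\pi:P\to M$, let $B$ be an $L(H)$-valued $\alpha$-equivariant $2$-form on $P$ vanishing on vertical vectors, and for a continuous vector field $\tilde w$ along an $\overline A$-horizontal piecewise $C^1$ path $\tilde c:[a,b]\to P$ let $$\omega_{(A,B)}(\tilde w)=A\bigl(\tilde w(a)\bigr)+\tau\left[\int_{a}^{b}B\bigl(\tilde c'(t),\tilde w(t)\bigr)\,dt\right].$$ Then $$\omega_{(A,B)}(\tilde v)=\omega_{(A,B)}(\tilde v\circ\phi)$$ for any strictly increasing piecewise $C^1$ bijective function $\phi:[t_0',t_1']\to[t_0,t_1]$, where on the left $\tilde v$ is along $\tilde\gamma$ and on the right $\tilde v\circ\phi$ is along $\tilde\gamma\circ\phi$.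
   Context: A crossed module $(G,H,\alpha,\tau)$ consists of groups $G,H$ and homomorphisms $\tau:H\to G$, $\alpha:G\to\mathrm{Aut}(H)$ with $\tau(\alpha(g)h)=g\tau(h)g^{-1}$ and $\alpha(\tau(h))(h')=hh'h^{-1}$ for all $g\in G$, $h,h'\in H$. It is a Lie crossed module if $G,H$ are Lie groups, $\tau$ is smooth, and $(g,h)\mapsto\alpha(g)h$ is smooth. $L(\cdot)$ denotes the Lie algebra; the derivatives $L(H)\to L(G)$ of $\tau$ and $L(H)\to L(H)$ of $\alpha(g)$ are again denoted $\tau$ and $\alpha(g)$. For $v\in T_pP$ and $g\in G$, $vg=dR_g|_p(v)\in T_{pg}P$, where $R_g(p)=pg$ is the right action. The $2$-form $B$ is $\alpha$-equivariant if $B_{pg}(vg,wg)=\alpha(g^{-1})B_p(v,w)$ for all $g\in G$, $p\in P$, $v,w\in T_pP$; it vanishes on vertical vectors if $B(v,w)=0$ whenever $v,w\in T_pP$ and $\pi_*v=0$. The curvature is $F^{\overline A}=d\overline A+\frac12[\overline A,\overline A]$, where $[\eta,\zeta](X,Y)=[\eta(X),\zeta(Y)]-[\eta(Y),\zeta(X)]$. A piecewise $C^1$ path $\tilde\gamma$ in $P$ is $\overline A$-horizontal if $\overline A(\tilde\gamma'(t))=0$ wherever $\tilde\gamma'(t)$ exists. A vector field along $\tilde\gamma$ is a map $\tilde v$ with $\tilde v(t)\in T_{\tilde\gamma(t)}P$. *)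

(* Defs.v *)
From HB Require Import structures.
From mathcomp Require Import all_boot all_order all_algebra.
From mathcomp Require Import all_classical all_reals all_analysis.

Set Implicit Arguments.
Unset Strict Implicit.
Unset Printing Implicit Defensive.

Import Order.TTheory GRing.Theory Num.Theory.
Import numFieldNormedType.Exports.

Local Open Scope classical_set_scope.
Local Open Scope ring_scope.

Reserved Notation "[ 'lie' x , y ]" (format "[ 'lie'  x ,  y ]").

(* Smooth finite-dimensional real manifolds, Lie groups, principal bundles and
   Lie-algebra valued forms, over an arbitrary model R of the real numbers.
   Conventions: "smooth" is C^oo; manifolds are Hausdorff, second countable,
   without boundary, of pure dimension n (n = 0 allowed); the Lie bracket is that
   of left-invariant vector fields; d is normalised by
   dA(X, Y) = X A(Y) - Y A(X) - A [X, Y]. *)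

Section SmoothMaps.
Context {R : realType} {V W : normedModType R}.

(* For U open; V and W are finite dimensional in all uses. *)
Fixpoint Ck_on (k : nat) (U : set V) (f : V -> W) : Prop :=
  match k with
  | 0 => forall x, U x -> {for x, continuous f}
  | k'.+1 => (forall x, U x -> differentiable f x) /\
             forall v : V, Ck_on k' U (fun x => 'd f x v)
  end.

Definition Coo_on (U : set V) (f : V -> W) : Prop := forall k, Ck_on k U f.

End SmoothMaps.

(* A chart is a homeomorphism from the open set cdom onto the open set
   cimg = cmap @` cdom; cmap and cinv are junk outside cdom and cimg. *)
Record chart (R : realType) (n : nat) (M : topologicalType) := Chart {
  cdom : set M ;
  cmap : M -> 'rV[R]_n ;
  cinv : 'rV[R]_n -> M ;
  open_cdom : open cdom ;
  open_cimg : open (cmap @` cdom) ;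
  cmapK : forall p, cdom p -> cinv (cmap p) = p ;
  cmap_cont : forall p, cdom p -> {for p, continuous cmap} ;
  cinv_cont : forall x, (cmap @` cdom) x -> {for x, continuous cinv} }.

Definition cimg (R : realType) n (M : topologicalType) (c : chart R n M) :
  set 'rV[R]_n := cmap c @` cdom c.

HB.mixin Record isManifold (R : realType) (n : nat) M of Topological M := {
  atlas : set (chart R n M) ;
  chart_at : M -> chart R n M ;
  chart_at_atlas : forall p, atlas (chart_at p) ;
  chart_at_dom : forall p, cdom (chart_at p) p ;
  atlas_compatible : forall c d, atlas c -> atlas d ->
    Coo_on (cmap c @` (cdom c `&` cdom d)) (cmap d \o cinv c) ;
  manifold_hausdorff : hausdorff_space M ;
  manifold_second_countable : @second_countable M }.

#[short(type="manifoldType")]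
HB.structure Definition Manifold (R : realType) (n : nat) :=
  { M of Topological M & isManifold R n M }.

Definition smooth_on (R : realType) m n (M : manifoldType R m)
    (N : manifoldType R n) (U : set M) (f : M -> N) : Prop :=
  (forall p, U p -> {for p, continuous f}) /\
  forall (c : chart R m M) (d : chart R n N), atlas c -> atlas d ->
    Coo_on (cmap c @` (U `&` cdom c `&` f @^-1` cdom d))
           (cmap d \o f \o cinv c).

Definition smooth (R : realType) m n (M : manifoldType R m)
    (N : manifoldType R n) (f : M -> N) : Prop := smooth_on setT f.

(* Smoothness of f on an open subset of the product manifold M1 x M2, with
   respect to the product charts. *)
Definition smooth2_on (R : realType) m1 m2 n (M1 : manifoldType R m1)
    (M2 : manifoldType R m2) (N : manifoldType R n) (U : set (M1 * M2))
    (f : M1 -> M2 -> N) : Prop :=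
  (forall p, U p -> {for p, continuous (fun q : M1 * M2 => f q.1 q.2)}) /\
  forall (c1 : chart R m1 M1) (c2 : chart R m2 M2) (d : chart R n N),
    atlas c1 -> atlas c2 -> atlas d ->
    Coo_on ((fun q : M1 * M2 => (cmap c1 q.1, cmap c2 q.2)) @`
              (U `&` (cdom c1 `*` cdom c2) `&` [set q | cdom d (f q.1 q.2)]))
           (fun x : 'rV[R]_m1 * 'rV[R]_m2 =>
              cmap d (f (cinv c1 x.1) (cinv c2 x.2))).

Definition smooth2 (R : realType) m1 m2 n (M1 : manifoldType R m1)
    (M2 : manifoldType R m2) (N : manifoldType R n) (f : M1 -> M2 -> N) : Prop :=
  smooth2_on setT f.

(* T_p M is R^n, a tangent vector at p being identified with its coordinates in
   the preferred chart chart_at p. *)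
Definition tangent (R : realType) n (M : manifoldType R n) (p : M) : Type :=
  'rV[R]_n.

Section Tangent.
#[local] Unset Implicit Arguments.
Context {R : realType} {n : nat} {M : manifoldType R n}.

(* Coordinates of v in an arbitrary chart c around p. *)
Definition tcoord (c : chart R n M) (p : M) (v : tangent p) : 'rV[R]_n :=
  'd (cmap c \o cinv (chart_at p)) (cmap (chart_at p) p) v.

(* The tangent vector with base point cinv c x and coordinates v in c. *)
Definition tvec (c : chart R n M) (x v : 'rV[R]_n) : tangent (cinv c x) :=
  'd (cmap (chart_at (cinv c x)) \o cinv c) x v.

End Tangent.

(* The differential T_p M -> T_q N of f at p, where q must be equal to f p; the
   target is explicit because f p and q need not be convertible, as with f 1
   and 1 for a group morphism f. *)
Definition dmap (R : realType) m n (M : manifoldType R m) (N : manifoldType R n)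
    (f : M -> N) (p : M) (q : N) (v : tangent p) : tangent q :=
  'd (cmap (chart_at q) \o f \o cinv (chart_at p)) (cmap (chart_at p) p) v.

Arguments dmap {R m n M N} f p q v.

HB.mixin Record isLieGroup (R : realType) (n : nat) G
    of Manifold R n G & Group G := {
  mulg_smooth : smooth2 (fun x y : G => (x * y)%g) ;
  invg_smooth : smooth (fun x : G => (x^-1)%g) }.

#[short(type="lieGroupType")]
HB.structure Definition LieGroup (R : realType) (n : nat) :=
  { G of Manifold R n G & Group G & isLieGroup R n G }.

Definition lie_alg (R : realType) n (G : lieGroupType R n) : Type :=
  tangent (1%g : G).

Section LieAlgebra.
#[local] Unset Implicit Arguments.
Context {R : realType} {n : nat} {G : lieGroupType R n}.

(* The left-invariant vector field generated by X, in the chart at 1. *)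
Definition left_inv_field (X : lie_alg G) (x : 'rV[R]_n) : 'rV[R]_n :=
  let c := chart_at (1%g : G) in
  'd (cmap c \o (fun y => cinv c x * y)%g \o cinv c) (cmap c 1%g) X.

Definition lie_bracket (X Y : lie_alg G) : lie_alg G :=
  let e := cmap (chart_at (1%g : G)) 1%g in
  'd (left_inv_field Y) e (left_inv_field X e)
  - 'd (left_inv_field X) e (left_inv_field Y e).

Definition Ad (g : G) (X : lie_alg G) : lie_alg G :=
  dmap (fun x : G => g * x * g^-1)%g 1%g 1%g X.

End LieAlgebra.

Notation "[ 'lie' x , y ]" := (lie_bracket x y) : ring_scope.

(* The derivative L(G) -> L(H) of a map f with f 1 = 1. *)
Definition lie_map (R : realType) m n (G : lieGroupType R m)
    (H : lieGroupType R n) (f : G -> H) (X : lie_alg G) : lie_alg H :=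
  dmap f 1%g 1%g X.

Arguments lie_map {R m n G H} f X.

Record lie_crossed_module (R : realType) m n (G : lieGroupType R m)
    (H : lieGroupType R n) := LieCrossedModule {
  tau : H -> G ;
  alpha : G -> H -> H ;
  tauM : forall h h', tau (h * h')%g = (tau h * tau h')%g ;
  alpha_aut : forall g h h', alpha g (h * h')%g = (alpha g h * alpha g h')%g ;
  alpha1 : forall h, alpha 1%g h = h ;
  alphaM : forall g g' h, alpha (g * g')%g h = alpha g (alpha g' h) ;
  tau_alpha : forall g h, tau (alpha g h) = (g * tau h * g^-1)%g ;
  alpha_tau : forall h h', alpha (tau h) h' = (h * h' * h^-1)%g ;
  tau_smooth : smooth tau ;
  alpha_smooth : smooth2 alpha }.

Record principal_bundle (R : realType) k m n (G : lieGroupType R k)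
    (P : manifoldType R m) (M : manifoldType R n) := PrincipalBundle {
  proj : P -> M ;
  act : P -> G -> P ;
  proj_smooth : smooth proj ;
  act_smooth : smooth2 act ;
  act1 : forall p, act p 1%g = p ;
  actM : forall p g g', act p (g * g')%g = act (act p g) g' ;
  proj_act : forall p g, proj (act p g) = proj p ;
  (* p |-> (proj p, psi p) is an equivariant diffeomorphism from
     proj @^-1` U onto U x G, with inverse sec *)
  locally_trivial : forall x : M,
    exists (U : set M) (psi : P -> G) (sec : M -> G -> P),
      [/\ open U /\ U x,
          smooth_on (proj @^-1` U) psi /\ smooth2_on (U `*` setT) sec,
          forall p g, U (proj p) -> psi (act p g) = (psi p * g)%g,
          forall p, U (proj p) -> sec (proj p) (psi p) = p &
          forall y g, U y -> proj (sec y g) = y /\ psi (sec y g) = g] }.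

Section Forms.
Context {R : realType} {m : nat} {P : manifoldType R m} {W : normedModType R}.

(* A_c(x)(u), the local expression of the 1-form A in the chart c. *)
Definition form1_local (A : forall p : P, tangent p -> W)
    (c : chart R m P) (x u : 'rV[R]_m) : W :=
  A (cinv c x) (tvec c x u).

Definition form2_local (B : forall p : P, tangent p -> tangent p -> W)
    (c : chart R m P) (x u v : 'rV[R]_m) : W :=
  B (cinv c x) (tvec c x u) (tvec c x v).

Record is_form1 (A : forall p : P, tangent p -> W) : Prop := {
  form1_linear : forall p, linear (A p) ;
  form1_smooth : forall (c : chart R m P) u, atlas c ->
    Coo_on (cimg c) (fun x => form1_local A c x u) }.

Record is_form2 (B : forall p : P, tangent p -> tangent p -> W) : Prop := {
  form2_linearl : forall p v, linear (fun u => B p u v) ;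
  form2_linearr : forall p u, linear (B p u) ;
  form2_alt : forall p u, B p u u = 0 ;
  form2_smooth : forall (c : chart R m P) u v, atlas c ->
    Coo_on (cimg c) (fun x => form2_local B c x u v) }.

(* dA_p(u, v) is computed in chart_at p, in which u and v are their own
   coordinates and extend to constant (hence commuting) fields. *)
Definition ext_deriv (A : forall p : P, tangent p -> W) (p : P)
    (u v : tangent p) : W :=
  let c := chart_at p in
  'd (fun x => form1_local A c x v) (cmap c p) u
  - 'd (fun x => form1_local A c x u) (cmap c p) v.

End Forms.

Arguments ext_deriv {R m P W} A p u v.

Section Connections.
#[local] Unset Implicit Arguments.
Context {R : realType} {k m n : nat} {G : lieGroupType R k}.
Context {P : manifoldType R m} {M : manifoldType R n}.

Definition form_bracket (eta zeta : forall p : P, tangent p -> lie_alg G)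
    (p : P) (u v : tangent p) : lie_alg G :=
  [lie (eta p u), (zeta p v)] - [lie (eta p v), (zeta p u)].

Definition curvature (A : forall p : P, tangent p -> lie_alg G) (p : P)
    (u v : tangent p) : lie_alg G :=
  ext_deriv A p u v + 2^-1 *: form_bracket A A p u v.

Context (E : principal_bundle G P M).

(* v |-> v g *)
Definition tact (p : P) (v : tangent p) (g : G) : tangent (act E p g) :=
  dmap (fun q => act E q g) p (act E p g) v.

(* The value at p of the fundamental vector field generated by X, that is the
   velocity at 0 of t |-> p exp(t X). *)
Definition fundamental (X : lie_alg G) (p : P) : tangent p :=
  dmap (act E p) 1%g p X.

#[local] Set Implicit Arguments.

Record is_connection (A : forall p : P, tangent p -> lie_alg G) : Prop := {
  connection_form : is_form1 A ;
  connection_equivariant : forall p (v : tangent p) g,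
    A (act E p g) (tact p v g) = Ad (g^-1)%g (A p v) ;
  connection_fundamental : forall p X, A p (fundamental X p) = X }.

Definition vanishes_on_vertical {W : normedModType R}
    (B : forall p : P, tangent p -> tangent p -> W) : Prop :=
  forall p (v w : tangent p),
    dmap (proj E) p (proj E p) v = 0 -> B p v w = 0.

Definition alpha_equivariant {l} {H : lieGroupType R l}
    (X : lie_crossed_module G H)
    (B : forall p : P, tangent p -> tangent p -> lie_alg H) : Prop :=
  forall p (v w : tangent p) g,
    B (act E p g) (tact p v g) (tact p w g) =
    lie_map (alpha X (g^-1)%g) (B p v w).

End Connections.

(* Paths [a, b] -> T are functions on R of which only the values on [a, b] are
   used; derivatives are taken within [a, b], so they are one-sided at the end
   points. *)
Section Paths.
#[local] Unset Implicit Arguments.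
Context {R : realType}.

Definition has_deriv_within {V : normedModType R} (a b : R) (f : R -> V)
    (t : R) (l : V) : Prop :=
  (fun s => (s - t)^-1 *: (f s - f t)) @ within `[a, b] t^' --> l.

Definition C1_fun (a b : R) (f : R -> R) : Prop :=
  exists2 f' : R -> R,
    {in `[a, b], forall t, has_deriv_within (V := R^o) a b f t (f' t)} &
    {within `[a, b], continuous f'}.

Definition piecewise_C1_fun (a b : R) (f : R -> R) : Prop :=
  {within `[a, b], continuous f} /\
  exists2 s, itv_partition a b s &
    forall i, (i < size s)%N -> C1_fun (nth b (a :: s) i) (nth b s i) f.

Context {m : nat} {P : manifoldType R m}.

Definition has_velocity (a b : R) (gamma : R -> P) (t : R)
    (u : tangent (gamma t)) : Prop :=
  gamma @ within `[a, b] (nbhs t) --> gamma t /\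
  has_deriv_within a b (cmap (chart_at (gamma t)) \o gamma) t u.

(* gamma'(t), and 0 at the times where gamma'(t) does not exist. *)
Definition velocity (a b : R) (gamma : R -> P) (t : R) : tangent (gamma t) :=
  xget (0 : 'rV[R]_m) [set u | has_velocity a b gamma t u].

(* v is continuous as a map [a, b] -> TP, given that gamma is continuous. *)
Definition continuous_along (a b : R) (gamma : R -> P)
    (v : forall t, tangent (gamma t)) : Prop :=
  forall c : chart R m P, atlas c ->
    {within `[a, b] `&` gamma @^-1` cdom c,
      continuous (fun t => tcoord c (gamma t) (v t))}.

Definition C1_path (a b : R) (gamma : R -> P) : Prop :=
  exists2 u : forall t, tangent (gamma t),
    {in `[a, b], forall t, has_velocity a b gamma t (u t)} &
    continuous_along a b gamma u.

Definition piecewise_C1_path (a b : R) (gamma : R -> P) : Prop :=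
  {within `[a, b], continuous gamma} /\
  exists2 s, itv_partition a b s &
    forall i, (i < size s)%N -> C1_path (nth b (a :: s) i) (nth b s i) gamma.

Definition horizontal {W : normedModType R} (A : forall p : P, tangent p -> W)
    (a b : R) (gamma : R -> P) : Prop :=
  {in `[a, b], forall t (u : tangent (gamma t)),
    has_velocity a b gamma t u -> A (gamma t) u = 0}.

Definition vint {d : nat} (a b : R) (f : R -> 'rV[R]_d) : 'rV[R]_d :=
  \row_i \int[lebesgue_measure]_(t in `[a, b]) f t 0 i.

(* The intended w are continuous vector fields along horizontal piecewise C^1
   paths c; the formula itself needs neither condition. *)
Definition omega {g h} {G : lieGroupType R g} {H : lieGroupType R h}
    (X : lie_crossed_module G H) (A : forall p : P, tangent p -> lie_alg G)
    (B : forall p : P, tangent p -> tangent p -> lie_alg H)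
    (a b : R) (c : R -> P) (w : forall t, tangent (c t)) : lie_alg G :=
  A (c a) (w a)
  + lie_map (tau X) (vint a b (fun t => B (c t) (velocity a b c t) (w t))).

End Paths.

(* Main.v *)
Require Import Defs.
From HB Require Import structures.
From mathcomp Require Import all_boot all_order all_algebra.
From mathcomp Require Import all_classical all_reals all_analysis.
From mathcomp Require Import measurable_realfun.
Import Order.TTheory GRing.Theory Num.Theory.
Import numFieldNormedType.Exports.
Local Open Scope classical_set_scope.
Local Open Scope ring_scope.

Set Implicit Arguments.
Unset Strict Implicit.
Unset Printing Implicit Defensive.

(* Only the integral of [B] changes under reparametrization.  On a subinterval
   where [phi] is C1 and maps into a piece on which [gamma] is C1, the integrand
   is continuous and the velocity of [gamma \o phi] is
   [phi' t *: gamma' (phi t)], so the claim is the change of variables formula.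
   Pieces are glued by additivity, first along the partition of [gamma]
   (transported by [phi]) and then along that of [phi]; the values at the
   partition points, where a velocity may fail to exist, are negligible. *)

(** * Derivatives within a closed interval *)

Lemma within_near_id {T : Type} (F : set_system T) {FF : Filter F} (D : set T) :
  F D -> within D F = F.
Proof.
move=> FD; apply/seteqP; split => A; rewrite /within /=; last first.
  by apply: filterS => x Ax _.
by move=> FA; apply: filterS (filterI FD FA) => x [Dx]; exact.
Qed.

Lemma itv_oo_nbhs {R : realType} (a b t : R) :
  t \in `]a, b[ -> nbhs t `[a, b]%classic.
Proof.
move=> tab; have : nbhs t `]a, b[%classic by apply: near_in_itvoo.
by apply: filterS => x; exact: subset_itv_oo_cc.
Qed.

Lemma has_deriv_withinE {R : realType} {V : normedModType R} (a b : R)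
    (f : R -> V) (t : R) (l : V) : t \in `]a, b[ ->
  has_deriv_within a b f t l <->
  (fun s => (s - t)^-1 *: (f s - f t)) @ t^' --> l.
Proof.
by move=> tab; rewrite /has_deriv_within within_near_id//; exact/nbhs_dnbhs/itv_oo_nbhs.
Qed.

Lemma has_deriv_within_subset {R : realType} {V : normedModType R}
    (a b c d : R) (f : R -> V) (t : R) (l : V) : `[a, b] `<=` `[c, d] ->
  has_deriv_within c d f t l -> has_deriv_within a b f t l.
Proof.
move=> sub; apply: cvg_trans; apply: cvg_app.
exact: within_subset.
Qed.

Lemma has_deriv_within_is_derive {R : realType} {V : normedModType R}
    (a b : R) (f : R -> V) (t : R) (l : V) : t \in `]a, b[ ->
  has_deriv_within a b f t l -> is_derive t 1 f l.
Proof.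
move=> tab /(has_deriv_withinE _ _ tab) fl.
(* Translation by [t] turns the quotient in [s] into the usual quotient in the increment [h], with
   [s = h + t]. *)
have sh : (fun h : R => h + t) @ 0^' --> t^'.
  move=> A; rewrite /dnbhs /within /= => tA.
  have : \forall h \near (0 : R), (fun s => s != t -> A s) (h + t).
    have : \forall s \near t, (fun s => s != t -> A s) s by exact: tA.
    by rewrite (near_shift 0 t) subr0.
  by apply: filterS => h /= hA h0; apply: hA; rewrite -subr_eq0 addrK.
have {fl sh} fl : h^-1 *: (f (h *: (1 : R) + t) - f t) @[h --> 0^'] --> l.
  have := cvg_comp _ _ sh fl; apply: cvg_trans; apply: near_eq_cvg.
  by near=> h; rewrite /= addrK /GRing.scale/= mulr1.
by apply: DeriveDef; [apply/cvg_ex; exists l|exact/cvg_lim].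
Unshelve. all: by end_near. Qed.

Lemma has_deriv_within_cvg {R : realType} {V : normedModType R}
    (a b : R) (f : R -> V) (t : R) (l : V) :
  has_deriv_within a b f t l -> f @ within `[a, b] (nbhs t) --> f t.
Proof.
move=> fl.
(* The point [t] may be left out of the filter: there [f s] is [f t], which lies in every
   neighbourhood of [f t]. *)
suff fD : f @ within `[a, b] t^' --> f t.
  move=> A fA.
  have tA : \forall s \near t, s != t -> `[a, b]%classic s -> A (f s) := fD A fA.
  change (\forall s \near t, `[a, b]%classic s -> A (f s)).
  apply: filterS tA => s sA sab.
  by have [->|/sA] := eqVneq s t; [exact: (nbhs_singleton fA)|exact].
have idt : (fun s : R => s - t) @ within `[a, b] t^' --> (0 : R).
  rewrite -(subrr t); apply: cvgB; last exact: cvg_cst.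
  by move=> A tA; apply: cvg_within; exact: nbhs_dnbhs.
have : (fun s => (s - t) *: ((s - t)^-1 *: (f s - f t)) + f t)
    @ within `[a, b] t^' --> 0 *: l + f t.
  by apply: cvgD; [exact: cvgZ|exact: cvg_cst].
rewrite scale0r add0r; apply: cvg_trans; apply: near_eq_cvg.
rewrite near_withinE; near=> s => _.
rewrite scalerA divff ?scale1r ?subrK// subr_eq0.
by near: s; exact: nbhs_dnbhs_neq.
Unshelve. all: by end_near. Qed.

(** * Integrals on closed intervals: end points and additivity *)

(** The end points form a null set, and adding them preserves measurability. This is what allows
    uncontrolled velocities at the ends of a piece. *)
Lemma integrable_itv_oo_cc {R : realType} (a b : R) (f : R -> R) :
  lebesgue_measure.-integrable `]a, b[ (EFin \o f) ->
  lebesgue_measure.-integrable `[a, b] (EFin \o f).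
Proof.
move=> /integrableP[mf fi]; apply/integrableP; split.
  exact: emeasurable_fun_itv_cc mf.
by rewrite integral_itv_bndoo//; apply/measurableT_comp.
Qed.

Lemma integrable_itv_cc_oo {R : realType} (a b : R) (f : R -> R) :
  lebesgue_measure.-integrable `[a, b] (EFin \o f) ->
  lebesgue_measure.-integrable `]a, b[ (EFin \o f).
Proof. by move=> fi; apply: integrableS fi => //; exact: subset_itv_oo_cc. Qed.

Lemma integrable_eq_itv_oo {R : realType} (a b : R) (f g : R -> R) :
  {in `]a, b[, f =1 g} -> lebesgue_measure.-integrable `[a, b] (EFin \o f) ->
  lebesgue_measure.-integrable `[a, b] (EFin \o g).
Proof.
move=> fg fi; apply: integrable_itv_oo_cc.
apply: (@eq_integrable _ _ _ lebesgue_measure `]a, b[ (measurable_itv _) (EFin \o f) (EFin \o g)).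
  by move=> x; rewrite inE/= => xab; rewrite fg.
exact: integrable_itv_cc_oo.
Qed.

Lemma Rintegral_eq_itv_oo {R : realType} (a b : R) (f g : R -> R) :
  {in `]a, b[, f =1 g} -> lebesgue_measure.-integrable `[a, b] (EFin \o f) ->
  \int[lebesgue_measure]_(x in `[a, b]) f x =
  \int[lebesgue_measure]_(x in `[a, b]) g x.
Proof.
move=> fg fi; rewrite /Rintegral; congr fine.
apply: eq_integral_itv_bounded => //; apply/measurable_EFinP.
- by have /integrableP[] := integrable_itv_cc_oo fi.
- by have /integrableP[] := integrable_itv_cc_oo (integrable_eq_itv_oo fg fi).
Qed.

Lemma integrable_Rintegral_itv_cat {R : realType} (a b c : R) (f : R -> R) :
  a <= b -> b <= c ->
  lebesgue_measure.-integrable `[a, b] (EFin \o f) ->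
  lebesgue_measure.-integrable `[b, c] (EFin \o f) ->
  lebesgue_measure.-integrable `[a, c] (EFin \o f) /\
  \int[lebesgue_measure]_(x in `[a, c]) f x =
  \int[lebesgue_measure]_(x in `[a, b]) f x +
  \int[lebesgue_measure]_(x in `[b, c]) f x.
Proof.
move=> ab bc fab fbc.
(* Removing [b] from the second interval makes the union with [[a, b]] disjoint. *)
have fbc' : lebesgue_measure.-integrable `]b, c] (EFin \o f).
  by apply: integrableS fbc => //; exact: subset_itv_oc_cc.
have fac : lebesgue_measure.-integrable `[a, c] (EFin \o f).
  rewrite (@itv_bndbnd_setU _ _ _ (BRight b)) ?bnd_simp//.
  have mU : measurable_fun (`[a, b] `|` `]b, c]) (EFin \o f).
    apply/measurable_funU => //.
    by split; [have /integrableP[] := fab|have /integrableP[] := fbc'].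
  apply/integrableP; split => //.
  rewrite ge0_integral_setU//.
  - by move/integrableP : fab => [_ ?]; move/integrableP : fbc' => [_ ?];
      rewrite lte_add_pinfty.
  - exact: measurableT_comp.
  - rewrite disj_set2E; apply/eqP/seteqP; split => x //= -[].
    by rewrite !in_itv/= => /andP[_ xb] /andP[/lt_geF]; rewrite xb.
split=> //.
rewrite -(Rintegral_itv_obnd_cbnd fbc') -(Rintegral_itvB fac) ?bnd_simp//.
by rewrite addrC subrK.
Qed.

(** * Subintervals and gluing along a partition *)

Lemma subset_itv_cc {R : realType} (a b c d : R) : c <= a -> b <= d ->
  `[a, b]%classic `<=` `[c, d]%classic.
Proof. by move=> ca bd; apply: subset_itvScc; rewrite bnd_simp. Qed.

Lemma C1_fun_subset {R : realType} (a b c d : R) (f : R -> R) :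
  c <= a -> b <= d -> C1_fun c d f -> C1_fun a b f.
Proof.
move=> ca bd [f' df cf]; have sub := subset_itv_cc ca bd; exists f'.
  by move=> t /sub tcd; apply: has_deriv_within_subset sub _; exact: df.
exact: continuous_subspaceW cf.
Qed.

(** An interval straddling the first partition point is cut there, and induction handles the rest.
    Arbitrary [x] and [y] are allowed because the lemma will be applied to images under [phi], whose
    ends need not be partition points of [gamma]. *)
Lemma itv_partition_interval_ind {R : realType} (Q : R -> R -> Prop) (a b : R)
    (s : seq R) : itv_partition a b s ->
  (forall x y z, a <= x -> x <= y -> y <= z -> z <= b ->
     Q x y -> Q y z -> Q x z) ->
  (forall i, (i < size s)%N -> forall x y,
     nth b (a :: s) i <= x -> x <= y -> y <= nth b s i -> Q x y) ->
  a < b -> forall x y, a <= x -> x <= y -> y <= b -> Q x y.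
Proof.
elim: s a => [a /itv_partition_nil-> _ _|c s IH a abs Qcat Qs _ x y ax xy yb].
  by rewrite ltxx.
have ac : a < c by case: abs => /andP[].
have cbs := itv_partition_cons abs.
have Qac := Qs 0%N isT.
have [yc|/ltW cy] := leP y c; first exact: Qac.
(* The induction hypothesis asks for [c < b]; if [b <= c], the interval lies in the first piece. *)
have [cb|bc] := ltP c b; last first.
  by apply: Qac => //=; exact: le_trans yb _.
have Qcb : forall x y, c <= x -> x <= y -> y <= b -> Q x y.
  apply: (IH c cbs) => //.
    by move=> x' y' z' cx'; apply: Qcat; exact: le_trans (ltW ac) cx'.
  by move=> i si; exact: (Qs i.+1).
have [cx|/ltW xc] := leP c x; first exact: Qcb.
by apply: (Qcat x c y) => //; [exact: Qac|exact: Qcb].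
Qed.

(** * Change of variables *)

Lemma cvg_into_within {T : Type} {U : Type} (F : set_system T) {FF : Filter F}
    (G : set_system U) (D : set U) (f : T -> U) :
  (\forall x \near F, D (f x)) -> f @ F --> G -> f @ F --> within D G.
Proof.
by move=> FD FG A GA; apply: filterS2 FD (FG _ GA) => x Dx; exact.
Qed.

(** The substitution formula is applied to the continuous [h]. That [f] and [g] agree with [h] and
    [(h \o phi) * phi'] on the open intervals is enough, since end points are negligible. *)
Lemma Rintegral_substitution_itv_oo {R : realType} (a b : R)
    (phi phi' f g h : R -> R) : a < b ->
  {in `[a, b] &, {homo phi : s t / s < t}} ->
  {in `[a, b], forall t, has_deriv_within (V := R^o) a b phi t (phi' t)} ->
  {within `[a, b], continuous phi'} ->
  {within `[phi a, phi b], continuous h} ->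
  {in `]phi a, phi b[, f =1 h} ->
  {in `]a, b[, forall t, g t = h (phi t) * phi' t} ->
  [/\ lebesgue_measure.-integrable `[a, b] (EFin \o g),
      lebesgue_measure.-integrable `[phi a, phi b] (EFin \o f) &
      \int[lebesgue_measure]_(s in `[phi a, phi b]) f s =
      \int[lebesgue_measure]_(t in `[a, b]) g t].
Proof.
move=> ab incr dphi cphi' ch fh gh.
have aab : a \in `[a, b] by rewrite in_itv/= lexx ltW.
have bab : b \in `[a, b] by rewrite in_itv/= lexx ltW.
have oocc t : t \in `]a, b[ -> t \in `[a, b] by exact: subset_itv_oo_cc.
have der t : t \in `]a, b[ -> is_derive t (1 : R) phi (phi' t).
  move=> tab; apply: (@has_deriv_within_is_derive _ R^o a b) => //.
  exact/dphi/oocc.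
have phi1 : {in `]a, b[, derive1 phi =1 phi'}.
  by move=> t tab; rewrite derive1E; have ? := der _ tab; rewrite derive_val.
have cphi : {within `[a, b], continuous phi}.
  apply/subspace_continuousP => t tab.
  by apply: has_deriv_within_cvg; exact: dphi.
have [cphio phia phib] := (continuous_within_itvP _ ab).1 cphi.
have [cphi'o phi'a phi'b] := (continuous_within_itvP _ ab).1 cphi'.
have homo_phi : {in `[a, b] &, {homo phi : s t / s <= t}}.
  move=> s t sab tab; rewrite le_eqVlt => /predU1P[->//|st].
  by rewrite ltW// incr.
have hphi : {within `[a, b], continuous (fun t => h (phi t) * phi' t)}.
  apply/subspace_continuousP => t tab.
  have tphi : phi t \in `[phi a, phi b].
    by rewrite in_itv/=; apply/andP; split; apply: (homo_phi _ _) => //; case/andP: (tab).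
  apply: cvgM; last exact: ((@subspace_continuousP _ _ _ phi').1 cphi' t tab).
  apply: (cvg_comp _ _ _ ((@subspace_continuousP _ _ _ h).1 ch (phi t) tphi)).
  apply: cvg_into_within; last exact: ((@subspace_continuousP _ _ _ phi).1 cphi t tab).
  rewrite near_withinE; near=> s => sab.
  by rewrite /= in_itv/=; apply/andP; split; apply: homo_phi => //; case/andP: sab.
have ih : lebesgue_measure.-integrable `[phi a, phi b] (EFin \o h).
  by apply: continuous_compact_integrable => //; exact: segment_compact.
have ihp : lebesgue_measure.-integrable `[a, b]
    (EFin \o (fun t => h (phi t) * phi' t)).
  by apply: continuous_compact_integrable => //; exact: segment_compact.
split.
- by apply: integrable_eq_itv_oo ihp => t tab; rewrite gh.
- by apply: integrable_eq_itv_oo ih => t tab; rewrite fh.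
rewrite -(Rintegral_eq_itv_oo _ ih); last by move=> t tab; rewrite fh.
have dphi_near t : t \in `]a, b[ -> \forall s \near t, derive1 phi s = phi' s.
  by move=> tab; near=> s; apply: phi1; near: s; exact: near_in_itvoo.
(* Here [phi'] is traded for [derive1 phi], which equals it inside but is not controlled at [a] and
   [b]. *)
transitivity (\int[lebesgue_measure]_(t in `[a, b]) ((h \o phi) * derive1 phi) t);
    last first.
  rewrite -(Rintegral_eq_itv_oo _ ihp).
    by apply: Rintegral_eq_itv_oo ihp => t tab; rewrite gh.
  by move=> t tab; rewrite /= -phi1.
(* The side conditions ask that the derivative be continuous inside with one-sided limits at the
   ends; [derive1 phi] inherits both from [phi']. *)
rewrite /Rintegral integration_by_substitution_increasing//.
- exact: ltW.
- move=> t tab; rewrite /continuous_at phi1//.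
  apply: cvg_trans (cphi'o t tab); apply: near_eq_cvg.
  by near=> s; apply/esym; near: s; exact: dphi_near.
- apply/cvg_ex; exists (phi' a); apply: cvg_trans phi'a; apply: near_eq_cvg.
  near=> t; rewrite phi1// in_itv/=; apply/andP; split; near: t.
    exact: nbhs_right_gt.
  exact: nbhs_right_lt.
- apply/cvg_ex; exists (phi' b); apply: cvg_trans phi'b; apply: near_eq_cvg.
  near=> t; rewrite phi1// in_itv/=; apply/andP; split; near: t.
    exact: nbhs_left_gt.
  exact: nbhs_left_lt.
- split => //.
  by move=> t tab; have ? := der _ tab; exact: ex_derive.
Unshelve. all: by end_near. Qed.

(** * Charts and transition maps *)

Lemma near_cdom {R : realType} {n : nat} {M : topologicalType}
    (c : chart R n M) (U : set M) (p : M) : cdom c p -> open U -> U p ->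
  \forall x \near cmap c p, U (cinv c x).
Proof.
move=> cp oU Up.
have cinvp : cinv c @ cmap c p --> cinv c (cmap c p).
  by apply: cinv_cont; exists p.
by apply: cinvp; apply: open_nbhs_nbhs; rewrite cmapK.
Qed.

Lemma near_cinvK {R : realType} {n : nat} {M : topologicalType}
    (c : chart R n M) (p : M) : cdom c p ->
  \forall x \near cmap c p, cmap c (cinv c x) = x.
Proof.
move=> cp; have : nbhs (cmap c p) (cmap c @` cdom c).
  by apply: open_nbhs_nbhs; split; [exact: open_cimg|exists p].
by apply: filterS => _ [q cq <-]; rewrite cmapK.
Qed.

Lemma differentiable_transition {R : realType} {n : nat}
    {M : manifoldType R n} (c d : chart R n M) (p : M) :
  atlas c -> atlas d -> cdom c p -> cdom d p ->
  differentiable (cmap d \o cinv c) (cmap c p).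
Proof.
move=> ac ad cp dp; have [dif _] := atlas_compatible c d ac ad 1%N.
by apply: dif; exists p.
Qed.

(** By the chain rule, since [g \o f] is the identity near [x]. The point [y] is kept separate from
    [f x] because for transition maps the two are equal only up to [cmapK]. *)
Lemma diff_cancel {R : realType} {U V : normedModType R} (f : U -> V)
    (g : V -> U) (x : U) (y : V) (u : U) : f x = y ->
  differentiable f x -> differentiable g y -> {near x, cancel f g} ->
  'd g y ('d f x u) = u.
Proof.
move=> <- df dg fgK.
rewrite -[LHS]/(('d g (f x) \o 'd f x) u) -(diff_comp df dg).
rewrite -deriveE; last exact: differentiable_comp.
by rewrite -[RHS](derive_id x u); apply: near_eq_derive.
Qed.

Lemma diff_transitionK {R : realType} {n : nat} {M : manifoldType R n}
    (c d : chart R n M) (p : M) (u : 'rV[R]_n) :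
  atlas c -> atlas d -> cdom c p -> cdom d p ->
  'd (cmap d \o cinv c) (cmap c p) ('d (cmap c \o cinv d) (cmap d p) u) = u.
Proof.
move=> ac ad cp dp; apply: diff_cancel.
- by rewrite /= cmapK.
- exact: differentiable_transition.
- exact: differentiable_transition.
near=> x; rewrite /= cmapK; last by near: x; exact: near_cdom (open_cdom c) cp.
by near: x; exact: near_cinvK.
Unshelve. all: by end_near. Qed.

(* Since [tangent p] depends on [p], the equality [cinv c (cmap c p) = p] has to
   be generalized before it can be used to identify the two base points. *)
Lemma form2_local_tcoord {R : realType} {m : nat} {P : manifoldType R m}
    {W : normedModType R} (B : forall p : P, tangent p -> tangent p -> W)
    (c : chart R m P) (p : P) (u v : tangent p) : atlas c -> cdom c p ->
  form2_local B c (cmap c p) (tcoord c p u) (tcoord c p v) = B p u v.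
Proof.
move=> ac cp; rewrite /form2_local /tvec /tcoord.
move: (cmapK cp); move: (cinv c (cmap c p)) => q qp.
subst q.
have ap := chart_at_atlas p; have dp := chart_at_dom p.
by congr (B p _ _); exact: diff_transitionK.
Qed.

(** * Local expressions and continuity of 2-forms *)

Lemma linear_row_sum {R : realType} {m : nat} {W : lmodType R}
    (f : 'rV[R]_m -> W) (u : 'rV[R]_m) : linear f ->
  f u = \sum_i u 0 i *: f (delta_mx 0 i).
Proof.
move=> lf; pose F : {linear 'rV[R]_m -> W} :=
  HB.pack f (GRing.isLinear.Build _ _ _ _ f lf).
rewrite -[f]/(F : _ -> _) {1}(row_sum_delta u) linear_sum.
by apply: eq_bigr => i _; rewrite linearZ.
Qed.

(** Smoothness of a form is stated for constant vectors; this expansion separates varying vectors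
    from the coefficient functions. *)
Lemma form2_local_sum {R : realType} {m : nat} {P : manifoldType R m}
    {W : normedModType R} (B : forall p : P, tangent p -> tangent p -> W)
    (c : chart R m P) (x u v : 'rV[R]_m) : is_form2 B ->
  form2_local B c x u v =
  \sum_i \sum_j (u 0 i * v 0 j) *:
    form2_local B c x (delta_mx 0 i) (delta_mx 0 j).
Proof.
move=> hB.
rewrite (@linear_row_sum _ _ _ (fun w => form2_local B c x w v) u); last first.
  by move=> k w w'; rewrite /form2_local /tvec linearP (form2_linearl hB).
apply: eq_bigr => i _.
rewrite (@linear_row_sum _ _ _ (form2_local B c x (delta_mx 0 i)) v); last first.
  by move=> k w w'; rewrite /form2_local /tvec linearP (form2_linearr hB).
by rewrite scaler_sumr; apply: eq_bigr => j _; rewrite scalerA.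
Qed.

Lemma cvg_sum {R : realType} {W : normedModType R} {T I : Type}
    (F : set_system T) {FF : Filter F} (r : seq I) (f : I -> T -> W)
    (l : I -> W) : (forall i, f i @ F --> l i) ->
  \sum_(i <- r) f i t @[t --> F] --> \sum_(i <- r) l i.
Proof.
move=> fl; elim: r => [|i r IH].
  by rewrite big_nil; under eq_fun do rewrite big_nil; exact: cvg_cst.
rewrite big_cons; under eq_fun do rewrite big_cons.
exact: cvgD.
Qed.

Lemma cvg_form2_local {R : realType} {m : nat} {P : manifoldType R m}
    {W : normedModType R} (B : forall p : P, tangent p -> tangent p -> W)
    (c : chart R m P) {T : Type} (F : set_system T) {FF : Filter F}
    (x u v : T -> 'rV[R]_m) (x0 u0 v0 : 'rV[R]_m) :
  is_form2 B -> atlas c -> cimg c x0 ->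
  x @ F --> x0 -> u @ F --> u0 -> v @ F --> v0 ->
  form2_local B c (x t) (u t) (v t) @[t --> F] --> form2_local B c x0 u0 v0.
Proof.
move=> hB ac cx0 xx0 uu0 vv0.
rewrite form2_local_sum//.
under eq_fun do rewrite form2_local_sum//.
have coord (w : T -> 'rV[R]_m) (w0 : 'rV[R]_m) i : w @ F --> w0 ->
    w t 0 i @[t --> F] --> w0 0 i.
  by move=> ww0; exact: cvg_comp _ _ ww0 (@coord_continuous _ _ _ 0 i w0).
apply: cvg_sum => i; apply: cvg_sum => j.
apply: cvgZ; first exact: cvgM (coord _ _ i uu0) (coord _ _ j vv0).
have cB := form2_smooth hB (delta_mx 0 i) (delta_mx 0 j) ac 0%N x0 cx0.
exact: cvg_comp _ _ xx0 cB.
Qed.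

Lemma continuous_along_tcoord {R : realType} {m : nat} {P : manifoldType R m}
    (a b : R) (gamma : R -> P) (v : forall t, tangent (gamma t))
    (c : chart R m P) (t : R) : {within `[a, b], continuous gamma} ->
  continuous_along a b gamma v -> atlas c -> t \in `[a, b] ->
  cdom c (gamma t) ->
  tcoord c (gamma s) (v s) @[s --> within `[a, b] (nbhs t)] -->
  tcoord c (gamma t) (v t).
Proof.
move=> cg cv ac tab ct.
have gc : \forall s \near within `[a, b] (nbhs t), cdom c (gamma s).
  have := (@subspace_continuousP _ _ _ gamma).1 cg t tab.
  by apply; apply: open_nbhs_nbhs; split => //; exact: open_cdom.
have := (@subspace_continuousP _ _ _ _).1 (cv c ac) t (conj tab ct).
apply: cvg_trans => A; rewrite /nbhs /= /within /= => tA.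
rewrite near_withinE in gc.
by apply: filterS2 gc tA => s cs As sab; apply: As; split => //; exact: cs.
Qed.

(** The chart at [gamma t] is kept fixed while [s] tends to [t]; [gamma s] eventually lies in it, so
    the values are given by the local expression there. *)
Lemma continuous_form2_along {R : realType} {m : nat} {P : manifoldType R m}
    {W : normedModType R} (B : forall p : P, tangent p -> tangent p -> W)
    (a b : R) (gamma : R -> P) (u v : forall t, tangent (gamma t)) :
  is_form2 B -> {within `[a, b], continuous gamma} ->
  continuous_along a b gamma u -> continuous_along a b gamma v ->
  {within `[a, b], continuous (fun t => B (gamma t) (u t) (v t))}.
Proof.
move=> hB cg cu cv; apply/subspace_continuousP => t tab.
pose c : chart R m P := chart_at (gamma t).
have ac : atlas c by exact: chart_at_atlas.
have ct : cdom c (gamma t) by exact: chart_at_dom.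
have gt := (@subspace_continuousP _ _ _ gamma).1 cg t tab.
have cgs : \forall s \near within `[a, b] (nbhs t), cdom c (gamma s).
  by apply: gt; apply: open_nbhs_nbhs; split => //; exact: open_cdom.
have := @cvg_form2_local _ _ _ _ B c _ (within `[a, b] (nbhs t)) _
  (cmap c \o gamma) _ _ (cmap c (gamma t)) _ _ hB ac
  (ex_intro2 _ _ _ ct erefl) (cvg_comp _ _ gt (cmap_cont ct))
  (continuous_along_tcoord cg cu ac tab ct)
  (continuous_along_tcoord cg cv ac tab ct).
rewrite form2_local_tcoord// => /(_ (within_filter _ _)).
apply: cvg_trans; apply: near_eq_cvg.
by apply: filterS cgs => s cs; rewrite /= form2_local_tcoord.
Qed.

(** * Velocities and the chain rule *)

Lemma velocityE {R : realType} {m : nat} {P : manifoldType R m}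
    (a b t : R) (gamma : R -> P) (u : tangent (gamma t)) :
  t \in `]a, b[ -> has_velocity a b gamma t u -> velocity a b gamma t = u.
Proof.
move=> tab vu; apply: xget_unique => // w [_ vw]; case: vu => _ vu.
move/(has_deriv_withinE _ _ tab): vw; move/(has_deriv_withinE _ _ tab): vu.
move=> vu vw; exact: (cvg_unique _ vw vu).
Qed.

Lemma has_velocity_subset {R : realType} {m : nat} {P : manifoldType R m}
    (a b c d t : R) (gamma : R -> P) (u : tangent (gamma t)) :
  `[a, b] `<=` `[c, d] -> has_velocity c d gamma t u ->
  has_velocity a b gamma t u.
Proof.
move=> sub [cg dg]; split; last exact: has_deriv_within_subset sub dg.
by apply: cvg_trans cg; apply: cvg_app; exact: within_subset.
Qed.

(** At a point interior to both intervals, either restriction leaves the neighbourhood filter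
    unchanged. Velocities on a piece thus become velocities on the whole interval. *)
Lemma has_velocity_interior {R : realType} {m : nat} {P : manifoldType R m}
    (a b c d t : R) (gamma : R -> P) (u : tangent (gamma t)) :
  t \in `]a, b[ -> t \in `]c, d[ -> has_velocity a b gamma t u ->
  has_velocity c d gamma t u.
Proof.
move=> tab tcd [cg dg]; split.
  by move: cg; rewrite !within_near_id//; exact: itv_oo_nbhs.
by apply: (has_deriv_withinE _ _ tcd).2; exact: (has_deriv_withinE _ _ tab).1 dg.
Qed.

Lemma has_velocity_comp {R : realType} {m : nat} {P : manifoldType R m}
    (a b c d t l : R) (phi : R -> R) (gamma : R -> P)
    (u : tangent (gamma (phi t))) : t \in `[a, b] ->
  {in `[a, b], forall s, phi s \in `[c, d]} -> {in `[a, b] &, injective phi} ->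
  has_deriv_within (V := R^o) a b phi t l ->
  has_velocity c d gamma (phi t) u ->
  has_velocity a b (gamma \o phi) t (l *: (u : 'rV[R]_m)).
Proof.
move=> tab phicd injphi dphi [cg dg].
have phit := has_deriv_within_cvg dphi.
have near_cd : \forall s \near within `[a, b] (nbhs t),
    `[c, d]%classic (phi s).
  by rewrite near_withinE; near=> s => sab; exact: phicd.
split.
  exact: cvg_comp _ _ (cvg_into_within near_cd phit) cg.
(* Injectivity gives [phi s != phi t] for [s != t], so the quotient of [gamma] at [phi s] makes
   sense and [phi s - phi t] can be cancelled below, even when [l = 0]. *)
have phit' : phi @ within `[a, b] t^' --> within `[c, d] (phi t)^'.
  apply: cvg_into_within.
    by rewrite near_withinE; near=> s => sab; exact: phicd.
  apply: cvg_into_within.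
    rewrite near_withinE; near=> s => sab; apply/negP => /eqP /injphi.
    move=> /(_ sab tab); apply/eqP; near: s; exact: nbhs_dnbhs_neq.
  move=> A phiA; have := phit A phiA.
  by rewrite !near_simpl !near_withinE; exact: nbhs_dnbhs.
have := cvgZ dphi (cvg_comp _ _ phit' dg) => /(_ (within_filter _ _)).
apply: cvg_trans; apply: near_eq_cvg; rewrite near_withinE; near=> s => sab.
rewrite /= scalerA -[(s - t)^-1 *: _]/((s - t)^-1 * (phi s - phi t)).
rewrite -mulrA divff ?mulr1//.
rewrite subr_eq0; apply/negP => /eqP /injphi.
by move=> /(_ sab tab); apply/eqP; near: s; exact: nbhs_dnbhs_neq.
Unshelve. all: by end_near. Qed.

(** * End points and restriction to subintervals *)

(** The preimage of [c] is at least [a], so [phi a <= c] by monotonicity, and [c <= phi a] as [phi]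
    takes values in [[c, d]]; similarly at [b]. *)
Lemma increasing_bij_itv_endpoints {R : realType} (a b c d : R)
    (phi : R -> R) : a <= b -> c <= d ->
  {in `[a, b] &, {homo phi : s t / s < t}} ->
  set_bij `[a, b] `[c, d] phi -> phi a = c /\ phi b = d.
Proof.
move=> ab cd incr [phicd _ phisurj].
have aab : `[a, b]%classic a by rewrite /= in_itv/= lexx ab.
have bab : `[a, b]%classic b by rewrite /= in_itv/= lexx ab.
have [] : `[c, d]%classic c /\ `[c, d]%classic d by rewrite /= !in_itv/= !lexx cd.
move=> /phisurj[s sab sc] /phisurj[t tab td].
have := phicd _ aab; have := phicd _ bab; rewrite /= !in_itv/=.
move=> /andP[_ phib] /andP[phia _]; split.
  apply/eqP; rewrite eq_le phia andbT -sc.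
  have := sab; rewrite /= in_itv/= => /andP[+ _].
  rewrite le_eqVlt => /predU1P[->//|as_]; exact/ltW/incr.
apply/eqP; rewrite eq_le phib /= -td.
have := tab; rewrite /= in_itv/= => /andP[_].
rewrite le_eqVlt => /predU1P[->//|tb]; exact/ltW/incr.
Qed.

Lemma C1_path_subset {R : realType} {m : nat} {P : manifoldType R m}
    (a b c d : R) (gamma : R -> P) :
  c <= a -> b <= d -> C1_path c d gamma -> C1_path a b gamma.
Proof.
move=> ca bd [u gu cu]; have sub := subset_itv_cc ca bd; exists u.
  by move=> t /sub tcd; apply: has_velocity_subset sub _; exact: gu.
by move=> e ae; apply: continuous_subspaceW (cu e ae); exact: setSI.
Qed.

Lemma C1_path_continuous {R : realType} {m : nat} {P : manifoldType R m}
    (a b : R) (gamma : R -> P) : C1_path a b gamma ->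
  {within `[a, b], continuous gamma}.
Proof.
by move=> [u gu _]; apply/subspace_continuousP => t /gu[].
Qed.

Lemma continuous_along_subset {R : realType} {m : nat} {P : manifoldType R m}
    (a b c d : R) (gamma : R -> P) (v : forall t, tangent (gamma t)) :
  c <= a -> b <= d -> continuous_along c d gamma v ->
  continuous_along a b gamma v.
Proof.
move=> ca bd cv e ae; apply: continuous_subspaceW (cv e ae).
by apply: setSI; exact: subset_itv_cc.
Qed.

Lemma integrable_itv1 {R : realType} (a : R) (f : R -> R) :
  lebesgue_measure.-integrable `[a, a] (EFin \o f).
Proof.
apply: integrable_itv_oo_cc; rewrite set_itvoo0; apply/integrableP; split.
  exact: measurable_fun_set0.
by rewrite integral_set0.
Qed.

(** * Reparametrization of one coordinate of the integral *)

Section Reparametrization.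
Context {R : realType} {m k : nat} {P : manifoldType R m}.
Context (B : forall p : P, tangent p -> tangent p -> 'rV[R]_k) (hB : is_form2 B).
Context (t0 t1 : R) (gamma : R -> P) (v : forall t, tangent (gamma t)).
Context (hv : continuous_along t0 t1 gamma v).
Context (t0' t1' : R) (phi : R -> R).
Context (incr : {in `[t0', t1'] &, {homo phi : s t / s < t}}).
Context (phi_itv : {in `[t0', t1'], forall t, phi t \in `[t0, t1]}).
Context (i : 'I_k).

(** Velocities refer to the whole intervals, so [f] and [g] do not change when the intervals are
    cut; at partition points they may involve the default velocity 0. *)
Let f (s : R) : R := B (velocity t0 t1 gamma s) (v s) 0 i.
Let g (t : R) : R := B (velocity t0' t1' (gamma \o phi) t) (v (phi t)) 0 i.

(** Integrability is part of the property because additivity of the integrals requires it when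
    pieces are glued. *)
Let substitution_on (a b : R) : Prop :=
  [/\ lebesgue_measure.-integrable `[a, b] (EFin \o g),
      lebesgue_measure.-integrable `[phi a, phi b] (EFin \o f) &
      \int[lebesgue_measure]_(s in `[phi a, phi b]) f s =
      \int[lebesgue_measure]_(t in `[a, b]) g t].

Let ndecr : {in `[t0', t1'] &, {homo phi : s t / s <= t}}.
Proof.
move=> s t sab tab; rewrite le_eqVlt => /predU1P[->//|st].
by rewrite ltW// incr.
Qed.

Let inj : {in `[t0', t1'] &, injective phi}.
Proof.
move=> s t sab tab st; have [lt|lt|//] := ltgtP s t.
  by have := incr sab tab lt; rewrite st ltxx.
by have := incr tab sab lt; rewrite st ltxx.
Qed.

Lemma substitution_on_cat a b c : t0' <= a -> a <= b -> b <= c -> c <= t1' ->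
  substitution_on a b -> substitution_on b c -> substitution_on a c.
Proof.
move=> ta ab bc ct [gab fab eab] [gbc fbc ebc].
have mem x : a <= x -> x <= c -> x \in `[t0', t1'].
  by move=> ax xc; rewrite in_itv/= (le_trans ta)// (le_trans xc).
have pab : phi a <= phi b by apply: ndecr => //; apply: mem => //; exact: le_trans bc.
have pbc : phi b <= phi c by apply: ndecr => //; apply: mem => //; exact: le_trans bc.
have [gac egac] := integrable_Rintegral_itv_cat ab bc gab gbc.
have [fac efac] := integrable_Rintegral_itv_cat pab pbc fab fbc.
by split=> //; rewrite egac efac eab ebc.
Qed.

Lemma substitution_on_C1 a b : t0' <= a -> a <= b -> b <= t1' ->
  C1_fun a b phi -> C1_path (phi a) (phi b) gamma -> substitution_on a b.
Proof.
move=> ta; rewrite le_eqVlt => /predU1P[<- _ _ _|ab bt].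
  by split; [exact: integrable_itv1..|rewrite !set_itv1 !Rintegral_set1].
move=> [phi' dphi cphi'] Cg; have [u gu cu] := Cg.
have cc x : x \in `[a, b] -> x \in `[t0', t1'].
  by apply: subset_itv_cc.
have oocc x : x \in `]a, b[ -> x \in `[a, b] by exact: subset_itv_oo_cc.
have ta' : phi a \in `[t0, t1] by apply/phi_itv/cc; rewrite in_itv/= lexx ltW.
have tb' : phi b \in `[t0, t1] by apply/phi_itv/cc; rewrite in_itv/= lexx ltW.
have incr_ab : {in `[a, b] &, {homo phi : s t / s < t}}.
  by move=> s t /cc sab /cc tab; exact: incr.
have ndecr_ab : {in `[a, b] &, {homo phi : s t / s <= t}}.
  by move=> s t /cc sab /cc tab; exact: ndecr.
have aab : a \in `[a, b] by rewrite in_itv/= lexx ltW.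
have bab : b \in `[a, b] by rewrite in_itv/= lexx ltW.
have pcc t : t \in `[a, b] -> phi t \in `[phi a, phi b].
  move=> tab; have /andP[at_ tb] : a <= t <= b by rewrite in_itv/= in tab.
  by rewrite in_itv/= !ndecr_ab.
(* The field [u] of velocities on the piece is continuous up to its ends, unlike
   [velocity t0 t1 gamma], so it serves to define [h]. *)
apply: (Rintegral_substitution_itv_oo (phi' := phi')
  (h := fun s => B (u s) (v s) 0 i)) => //.
- have cB : {within `[phi a, phi b], continuous (fun s => B (u s) (v s))}.
    apply: continuous_form2_along => //; first exact: C1_path_continuous.
    apply: continuous_along_subset hv.
      by move: ta'; rewrite in_itv/= => /andP[].
    by move: tb'; rewrite in_itv/= => /andP[].
  by move=> s; exact: cvg_comp _ _ (cB s) (@coord_continuous _ _ _ 0 i _).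
- move=> s sab; rewrite /f (@velocityE _ _ _ _ _ _ _ (u s))//.
    move: sab ta' tb'; rewrite !in_itv/= => /andP[as_ sb] /andP[t0a _] /andP[_ bt1].
    by rewrite (le_lt_trans t0a)//= (lt_le_trans sb).
  apply: has_velocity_interior (gu s _) => //; last exact: subset_itv_oo_cc.
  move: sab ta' tb'; rewrite !in_itv/= => /andP[as_ sb] /andP[t0a _] /andP[_ bt1].
  by rewrite (le_lt_trans t0a)//= (lt_le_trans sb).
- move=> t tab.
  have tt : t \in `]t0', t1'[.
    by move: tab; rewrite !in_itv/= => /andP[at_ tb];
       rewrite (le_lt_trans ta)//= (lt_le_trans tb).
  have vel : has_velocity t0' t1' (gamma \o phi) t
      (phi' t *: (u (phi t) : 'rV[R]_m)).
    apply: (has_velocity_interior tab tt).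
    have inj_ab : {in `[a, b] &, injective phi}.
      by move=> x y /cc xab /cc yab; exact: inj.
    exact: has_velocity_comp (oocc t tab) pcc inj_ab (dphi t (oocc t tab))
      (gu _ (pcc t (oocc t tab))).
  rewrite /g (velocityE tt vel).
  rewrite (scalable_linear (form2_linearl hB (v (phi t)))).
  by rewrite mxE mulrC.
Qed.
(** First gluing: on an interval where [phi] is C1, the partition of [gamma] is pulled back by
    [phi]. *)
Lemma substitution_on_C1_fun p q : t0 < t1 -> piecewise_C1_path t0 t1 gamma ->
  `[t0, t1] `<=` phi @` `[t0', t1'] ->
  t0' <= p -> q <= t1' -> C1_fun p q phi ->
  forall x y, p <= x -> x <= y -> y <= q -> substitution_on x y.
Proof.
move=> t01 [_ [s ps Cs]] surj tp qt Cphi.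
(* The property is indexed by the image interval, so that induction can run along the partition of
   [[t0, t1]]. *)
pose Q c d := forall x y, p <= x -> x <= y -> y <= q -> phi x = c -> phi y = d ->
  substitution_on x y.
have mem x : p <= x -> x <= q -> x \in `[t0', t1'].
  by move=> px xq; rewrite in_itv/= (le_trans tp)// (le_trans xq).
suff HQ c d : t0 <= c -> c <= d -> d <= t1 -> Q c d.
  move=> x y px xy yq.
  have xm : x \in `[t0', t1'] by apply: mem => //; exact: le_trans yq.
  have ym : y \in `[t0', t1'] by apply: mem => //; exact: le_trans xy.
  have /andP[tx _] : t0 <= phi x <= t1 by have := phi_itv xm; rewrite in_itv.
  have /andP[_ yt] : t0 <= phi y <= t1 by have := phi_itv ym; rewrite in_itv.
  apply: (HQ (phi x) (phi y)) => //; exact: ndecr.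
move: c d; apply: (itv_partition_interval_ind ps) => //.
  move=> c e d tc ce ed dt Qce Qed x y px xy yq phix phiy.
  have xm : x \in `[t0', t1'] by apply: mem => //; exact: le_trans yq.
  have ym : y \in `[t0', t1'] by apply: mem => //; exact: le_trans xy.
  (* Surjectivity lifts the cut [e] to a time [z], and strict monotonicity places it between [x] and
     [y]. *)
  have [z zm phiz] : (phi @` `[t0', t1']) e.
    by apply: surj; rewrite /= in_itv/= (le_trans tc)// (le_trans ed).
  have xz : x <= z.
    by rewrite leNgt; apply/negP => /(incr zm xm); rewrite phix phiz ltNge ce.
  have zy : z <= y.
    by rewrite leNgt; apply/negP => /(incr ym zm); rewrite phiy phiz ltNge ed.
  apply: (@substitution_on_cat x z y) => //.
  - exact: le_trans px.
  - exact: le_trans qt.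
  - by apply: Qce => //; exact: le_trans yq.
  - by apply: Qed => //; exact: le_trans xz.
move=> j js c d sc cd ds x y px xy yq phix phiy.
apply: substitution_on_C1 => //.
- exact: le_trans px.
- exact: le_trans qt.
- exact: C1_fun_subset Cphi.
- by rewrite phix phiy; apply: C1_path_subset (Cs j js).
Qed.

(** Second gluing, along the partition of [phi] itself. *)
Lemma substitution_on_itv : t0 < t1 -> t0' < t1' ->
  piecewise_C1_path t0 t1 gamma -> piecewise_C1_fun t0' t1' phi ->
  `[t0, t1] `<=` phi @` `[t0', t1'] -> substitution_on t0' t1'.
Proof.
move=> t01 t01' Cg [_ [s ps Cs]] surj.
apply: (itv_partition_interval_ind ps) => //; last exact: ltW.
  by move=> x y z; exact: substitution_on_cat.
move=> j js; apply: substitution_on_C1_fun => //; last exact: Cs.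
  by apply: (itv_partition_nth_ge _ ps); exact: ltnW.
(* The right end [nth _ s j] of piece [j] is entry [j.+1] of [t0' :: s]. *)
exact: (@itv_partition_nth_le _ _ _ _ _ j.+1 js ps).
Qed.

End Reparametrization.

(** * Invariance of [omega] *)

Theorem proposition2p2 (R : realType) (dG dH dP dM : nat)
  (G : lieGroupType R dG) (H : lieGroupType R dH) (X : lie_crossed_module G H)
  (P : manifoldType R dP) (M : manifoldType R dM) (E : principal_bundle G P M)
  (Abar : forall p : P, tangent p -> lie_alg G) (hAbar : is_connection E Abar)
  (t0 t1 : R) (ht : t0 < t1)
  (gamma : R -> P) (hgamma : piecewise_C1_path t0 t1 gamma)
  (hhor : horizontal Abar t0 t1 gamma)
  (v : forall t : R, tangent (gamma t)) (hv : continuous_along t0 t1 gamma v)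
  (hvA : {in `[t0, t1], forall t : R,
     Abar (gamma t) (v t) = Abar (gamma t0) (v t0)
       + vint t0 t (fun s => curvature Abar (gamma s)
                               (velocity t0 t1 gamma s) (v s))})
  (A : forall p : P, tangent p -> lie_alg G) (hA : is_connection E A)
  (B : forall p : P, tangent p -> tangent p -> lie_alg H) (hB : is_form2 B)
  (hBeq : alpha_equivariant E X B) (hBvert : vanishes_on_vertical E B)
  (t0' t1' : R) (ht' : t0' < t1')
  (phi : R -> R) (hphi : piecewise_C1_fun t0' t1' phi)
  (hinc : {in `[t0', t1'] &, {homo phi : s t / s < t}})
  (hbij : set_bij `[t0', t1'] `[t0, t1] phi) :
  omega X A B t0 t1 gamma v
  = omega X A B t0' t1' (gamma \o phi) (fun s => v (phi s)).
Proof.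
have [phi_mem _ surj] := hbij.
have [phi0 phi1] := increasing_bij_itv_endpoints (ltW ht') (ltW ht) hinc hbij.
rewrite /omega /=; congr (_ + _); first by rewrite phi0.
(* Since [vint] integrates coordinatewise, one coordinate [i] at a time suffices. *)
congr (lie_map _ _); apply/rowP => i; rewrite !mxE.
have [_ _] := substitution_on_itv hB hv hinc phi_mem i ht ht' hgamma hphi surj.
by rewrite phi0 phi1.
Qed.
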